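(* Let $\mu$ be a probability measure supported on a symmetric convex domain $\Omega\subset\mathbb R^n$ satisfying the dilation inequality for $\mathcal K_s^n(\Omega)$ with constant $\kappa>0$. Then for every $f\in\mathrm{QC}^1(\Omega,\mu)$, $$\mathrm{Ent}_\mu(f)\le\frac1\kappa\int_\Omega\Phi_f\,d\mu.$$ In addition, if $f\in\mathrm{QC}^1(\Omega,\mu)\cap C^1(\Omega)$, then $\mathrm{Ent}_\mu(f)\le\frac2\kappa\int_\Omega\langle x,\nabla f(x)\rangle\,d\mu(x)$.
   Context: Symmetric set: $K=-K$; symmetric function: $f(x)=f(-x)$; quasi-convex: $\{f<\lambda\}$ convex for all $\lambda$. Symmetric convex domain: nonempty open convex $\Omega=-\Omega\subset\mathbb R^n$. $\mathcal K_s^n(\Omega)$: nonempty symmetric open convex subsets of $\Omega$. For Borel $A\subset\mathbb R^n$, $\varepsilon\in(0,1)$: $A_\varepsilon:=A\cup\{x:\exists y,\ \int_0^1\mathbf 1_A((1-t)x+ty)\,dt>1-\varepsilon\}$; $\mu^*(A):=\liminf_{\varepsilon\downarrow0}(\mu(A_\varepsilon)-\mu(A))/\varepsilon$. $\mu$ satisfies the dilation inequality for $\mathcal K_s^n(\Omega)$ with $\kappa$ if $\mu^*(K)\ge-\kappa(1-\mu(K))\log(1-\mu(K))$ for all $K\in\mathcal K_s^n(\Omega)$. $\mathrm{Ent}_\mu(f):=\int f\log f\,d\mu-\int f\,d\mu\log\int f\,d\mu$. For nonnegative symmetric quasi-convex $f$, $\Phi_f(x):=\limsup_{\varepsilon\downarrow0}\frac{f(x)-f(\frac{1-\varepsilon}{1+\varepsilon}x)}{\varepsilon}$.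 $\mathrm{QC}(\Omega,\mu)$: all nonnegative, continuous, symmetric quasi-convex $f$ on $\Omega$ for which there exist a nonnegative Borel $g\in L^1(\mu)$ and $\varepsilon_0\in(0,1]$ with $\sup_{\varepsilon\in(0,\varepsilon_0)}\frac{f(x)-f(\frac{1-\varepsilon}{1+\varepsilon}x)}{\varepsilon}\le g(x)$ for all $x\in\Omega$. $\mathrm{QC}^p(\Omega,\mu):=\{f: f^p\in\mathrm{QC}(\Omega,\mu)\cap L^1(\mu)\}$. *)

(* Defs.v *)
From HB Require Import structures.
From mathcomp Require Import all_boot all_order all_algebra.
From mathcomp Require Import all_classical all_reals all_analysis.
Set Implicit Arguments. Unset Strict Implicit. Unset Printing Implicit Defensive.
Import Order.TTheory GRing.Theory Num.Theory numFieldNormedType.Exports.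
Local Open Scope classical_set_scope.
Local Open Scope ring_scope.

(* R^n is modelled as row vectors 'rV[R]_n (product topology);
   [Rn R n] is the same carrier equipped with the Borel sigma-algebra
   (the sigma-algebra generated by the open sets). *)
Definition Rn (R : realType) (n : nat) := g_sigma_algebraType (@open 'rV[R]_n).

Section Defs.
Context {R : realType} {n : nat}.
Local Notation V := 'rV[R]_n.
Local Notation RN := (Rn R n).

Definition convex_set_ (A : set V) : Prop :=
  forall x y (t : R), A x -> A y -> 0 <= t <= 1 -> A ((1 - t) *: x + t *: y).

Definition symmetric_set (A : set V) : Prop := [set - x | x in A] = A.

Definition symmetric_convex_domain (Om : set V) : Prop :=
  [/\ Om !=set0, open Om, convex_set_ Om & symmetric_set Om].

Definition Ksn (Om : set V) : set (set V) :=
  [set K | [/\ K !=set0, symmetric_set K, open K, convex_set_ K & K `<=` Om]].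

Definition seg_frac (A : set V) (x y : V) : \bar R :=
  (\int[lebesgue_measure]_(t in `[0%R, 1%R]) (\1_A ((1 - t) *: x + t *: y))%:E)%E.

Definition dilate_set (A : set V) (e : R) : set V :=
  A `|` [set x | exists y, ((1 - e)%:E < seg_frac A x y)%E].

(* mu^*(A) = liminf_{eps -> 0+} (mu(A_eps) - mu(A)) / eps,
   liminf written out as sup_{0<d<=1} inf_{0<eps<d} *)
Definition mu_star (mu : set RN -> \bar R) (A : set V) : \bar R :=
  ereal_sup [set ereal_inf [set ((mu (dilate_set A e : set RN) - mu (A : set RN))
                                   * (e^-1)%:E)%E | e in `]0%R, d[]
            | d in `]0%R, 1%R]].

(* dilation inequality for K_s^n(Omega) with constant kappa
   (convention 0 * log 0 = 0, which holds since ln 0 = 0) *)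
Definition dilation_ineq (mu : set RN -> \bar R) (Om : set V) (kappa : R) : Prop :=
  forall K, Ksn Om K ->
    ((- kappa * (1 - fine (mu (K : set RN))) * ln (1 - fine (mu (K : set RN))))%:E
       <= mu_star mu K)%E.

(* Ent_mu(f) (with 0 log 0 = 0) *)
Definition Ent (mu : {measure set RN -> \bar R}) (Om : set V) (f : V -> R) : \bar R :=
  (\int[mu]_(x in (Om : set RN)) (f x * ln (f x))%:E
   - (\int[mu]_(x in (Om : set RN)) (f x)%:E)
       * (ln (fine (\int[mu]_(x in (Om : set RN)) (f x)%:E)))%:E)%E.

Definition dq (f : V -> R) (x : V) (e : R) : R :=
  (f x - f (((1 - e) / (1 + e)) *: x)) / e.

(* Phi_f(x) = limsup_{eps -> 0+} dq f x eps,
   limsup written out as inf_{0<d<=1} sup_{0<eps<d} *)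
Definition Phi (f : V -> R) (x : V) : \bar R :=
  ereal_inf [set ereal_sup [set (dq f x e)%:E | e in `]0%R, d[]
            | d in `]0%R, 1%R]].

Definition QC (mu : {measure set RN -> \bar R}) (Om : set V) (f : V -> R) : Prop :=
  [/\ (forall x, Om x -> 0 <= f x),
      {within Om, continuous f},
      (forall x, Om x -> f (- x) = f x),
      (forall l : R, convex_set_ [set x | Om x /\ f x < l]) &
      exists (g : RN -> R) (e0 : R),
        [/\ (forall x, 0 <= g x),
            measurable_fun setT g,
            mu.-integrable setT (EFin \o g),
            0 < e0 <= 1 &
            forall x, Om x -> forall e, 0 < e < e0 -> dq f x e <= g x]].

Definition QC1 (mu : {measure set RN -> \bar R}) (Om : set V) (f : V -> R) : Prop :=
  QC mu Om f /\ mu.-integrable (Om : set RN) (EFin \o f).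

Definition C1_on (Om : set V) (f : V -> R) : Prop :=
  (forall x, Om x -> differentiable f x) /\
  (forall i : 'I_n, {within Om, continuous (fun x => 'D_(delta_mx 0 i) f x)}).

Definition x_dot_grad (f : V -> R) (x : V) : R :=
  \sum_(i < n) x 0 i * 'D_(delta_mx 0 i) f x.

End Defs.

(* Main.v *)
(* Write [m l] for the mass of the superlevel set [f >= l].  For a symmetric
   open convex [K] the dilation [K_e] is exactly [(1 + e) / (1 - e) K], so the
   dilation inequality for [K = {f < l}] bounds [- kappa m(l) ln m(l)] by the
   lower limit of [mu {f (s x) < l <= f x} / e], where [s = (1 - e) / (1 + e)].
   Integrating in [l], Fatou's lemma and Tonelli turn this into
   [kappa * int (- m ln m) dl <= liminf int (f x - f (s x)) / e dmu], and the
   right-hand side is at most [int Phi_f] by the reverse Fatou lemma, with the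
   majorant [g] of the class QC.  On the other side, entropy is a convex
   1-homogeneous functional and [f] is the integral of the indicators of its
   superlevel sets, so [Ent f] is at most the integral of their entropies, which
   are [- m ln m].  In the C^1 case, [Phi_f x = 2 <x, grad f x>]. *)
Require Import Defs.
From HB Require Import structures.
From mathcomp Require Import all_boot all_order all_algebra.
From mathcomp Require Import all_classical all_reals all_analysis.
From mathcomp Require Import measurable_realfun ring lra.
Import Order.TTheory GRing.Theory Num.Theory numFieldNormedType.Exports.
Local Open Scope classical_set_scope.
Local Open Scope ring_scope.

(** * Dilations of symmetric convex sets *)

Section Dilation.
Set Implicit Arguments. Unset Strict Implicit.
Variables (R : realType) (n : nat).
Implicit Types (K : set 'rV[R]_n) (x y p q : 'rV[R]_n).

Lemma symmetric_setN K x : symmetric_set K -> K x -> K (- x).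
Proof. by move=> sK Kx; rewrite -sK; exists x. Qed.

Lemma symmetric_convex0 K : K !=set0 -> symmetric_set K -> convex_set_ K -> K 0.
Proof.
move=> [x Kx] sK cK.
have -> : 0 = (1 - 2^-1) *: x + 2^-1 *: (- x).
  by rewrite scalerN -scalerBl (_ : 1 - 2^-1 - 2^-1 = 0) ?scale0r//; field.
by apply: cK => //; [exact: symmetric_setN|lra].
Qed.

(** The missing weight [1 - (a + b)] is put on the origin. *)
Lemma convex_set_subcomb K (a b : R) p q : convex_set_ K -> K 0 -> K p -> K q ->
  0 <= a -> 0 <= b -> a + b <= 1 -> K (a *: p + b *: q).
Proof.
move=> cK K0 Kp Kq a0 b0 ab1.
have [ab0|abN0] := eqVneq (a + b) 0.
  have -> : a = 0 by lra.
  have -> : b = 0 by lra.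
  by rewrite !scale0r addr0.
have ab_gt0 : 0 < a + b by rewrite lt_def abN0 addr_ge0.
have -> : a *: p + b *: q =
    (1 - (a + b)) *: 0 + (a + b) *: ((1 - b / (a + b)) *: p + (b / (a + b)) *: q).
  by rewrite scaler0 add0r scalerDr !scalerA; congr (_ *: _ + _ *: _); field.
apply: (cK) => //; last by apply/andP; split=> //; exact: ltW.
apply: cK => //; apply/andP; split; first by rewrite divr_ge0// ltW.
by rewrite ler_pdivrMr// mul1r; lra.
Qed.

Lemma convex_set_shrink K (s : R) x : convex_set_ K -> K 0 -> K x ->
  0 <= s <= 1 -> K (s *: x).
Proof.
move=> cK K0 Kx /andP[s0 s1]; rewrite -[s *: x]addr0 -(scale0r x).
by apply: convex_set_subcomb => //; rewrite addr0.
Qed.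

Lemma open_scale_preimage (A : set 'rV[R]_n) (s : R) :
  open A -> open [set x | A (s *: x)].
Proof.
move=> oA; apply: (open_comp (f := fun x => s *: x)) => // x _.
exact: scaler_continuous.
Qed.

Lemma open_segment_preimage (A : set 'rV[R]_n) x y :
  open A -> open [set t : R | A ((1 - t) *: x + t *: y)].
Proof.
move=> oA.
apply: (open_comp (f := fun t : R => (1 - t) *: x + t *: y)) => // t _.
apply: cvgD; apply: cvgZr_tmp; last exact: cvg_id.
by apply: cvgB; [exact: cvg_cst|exact: cvg_id].
Qed.

Lemma measurable_segment (A : set 'rV[R]_n) x y :
  open A -> measurable [set t : R | A ((1 - t) *: x + t *: y)].
Proof. by move=> oA; apply: open_measurable; exact: open_segment_preimage. Qed.

Lemma seg_fracE K x y : open K ->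
  seg_frac K x y =
  lebesgue_measure ([set t : R | K ((1 - t) *: x + t *: y)] `&` `[0%R, 1%R]).
Proof.
move=> oK; rewrite /seg_frac.
by rewrite -integral_indic//; exact: measurable_segment.
Qed.

(** Otherwise any two parameters in [T] differ by at most [1 - e], so [T] lies in an interval of
    that length ending at [sup T], which contradicts its measure. *)
Lemma gap_of_seg_frac K x y (e : R) : open K -> 0 < e < 1 ->
  ((1 - e)%:E < seg_frac K x y)%E ->
  exists t1 t2 : R, [/\ 0 <= t1, t2 <= 1, 1 - e < t2 - t1,
    K ((1 - t1) *: x + t1 *: y) & K ((1 - t2) *: x + t2 *: y)].
Proof.
move=> oK /andP[e0 e1]; rewrite seg_fracE//; set T := (X in lebesgue_measure X).
move=> ltT; apply: contrapT => noT.
have T_gap t1 t2 : T t1 -> T t2 -> t2 - t1 <= 1 - e.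
  move=> [/= K1 t1_01] [/= K2 t2_01]; rewrite leNgt; apply/negP => t12.
  move: t1_01 t2_01; rewrite !in_itv/= => /andP[t10 _] /andP[_ t21].
  by apply: noT; exists t1, t2.
have mT : measurable T.
  by apply: measurableI => //; exact: measurable_segment.
have [T0|/set0P[t0 Tt0]] := eqVneq T set0.
  by move: ltT; rewrite T0 measure0 lte_fin; lra.
have supT : has_sup T.
  split; first by exists t0.
  by exists 1 => t [_ /=]; rewrite in_itv/= => /andP[].
have Tsub : T `<=` `[sup T - (1 - e), sup T].
  move=> t Tt; rewrite /= in_itv/=; apply/andP; split; last first.
    by apply: ub_le_sup => //; case: supT.
  rewrite lerBlDr; apply: ge_sup; first by exists t0.
  by move=> u Tu; have := T_gap _ _ Tt Tu; lra.
have : (lebesgue_measure T <= lebesgue_measure `[(sup T - (1 - e))%R, sup T]%classic)%E.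
  by apply: le_measure => //; rewrite inE.
rewrite lebesgue_measure_itv/= lte_fin.
have -> : sup T - (1 - e) < sup T by lra.
rewrite -EFinD => /(lt_le_trans ltT); rewrite lte_fin; lra.
Qed.

(** The segment from [x] to [- (s *: x)] meets [s *: x] at the parameter [t0 = (1 - s) / (1 + s)].
    From there on it runs between [s *: x] and its opposite, hence in [K], and [1 - t0] is the
    stated bound. *)
Lemma seg_frac_opp_ge K x (s : R) : open K -> convex_set_ K -> symmetric_set K ->
  0 < s < 1 -> K (s *: x) ->
  ((2 * s / (1 + s))%:E <= seg_frac K x (- (s *: x)))%E.
Proof.
move=> oK cK sK /andP[s0 s1] Ksx.
have K0 : K 0 by apply: symmetric_convex0 => //; exists (s *: x).
rewrite seg_fracE//.
set t0 := (1 - s) / (1 + s).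
have t0_01 : 0 <= t0 <= 1.
  by apply/andP; split; rewrite /t0 ?divr_ge0 ?ler_pdivrMr; lra.
have le_t0 t : t0 <= t -> 1 - s <= t * (1 + s).
  by rewrite /t0 ler_pdivrMr//; lra.
have sub : `[t0, 1] `<=`
    [set t : R | K ((1 - t) *: x + t *: - (s *: x))] `&` `[0%R, 1%R].
  move=> t /=; rewrite !in_itv/= => /andP[t0t t1]; split; last first.
    by case/andP: t0_01 => ? _; apply/andP; split=> //; lra.
  have := le_t0 _ t0t => lt0.
  have -> : (1 - t) *: x + t *: - (s *: x) =
     ((s + (1 - t * (1 + s))) / (2 * s)) *: (s *: x) +
     ((s - (1 - t * (1 + s))) / (2 * s)) *: (- (s *: x)).
    rewrite !scalerN !scalerA -2!scalerBl; congr (_ *: _); field; lra.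
  apply: convex_set_subcomb => //; first exact: symmetric_setN.
  - by rewrite divr_ge0//; nra.
  - by rewrite divr_ge0//; nra.
  - by rewrite -mulrDl ler_pdivrMr; lra.
have mS : measurable
    ([set t : R | K ((1 - t) *: x + t *: - (s *: x))] `&` `[0%R, 1%R]).
  by apply: measurableI => //; exact: measurable_segment.
apply: (@le_trans _ _ (lebesgue_measure `[t0, 1%R]%classic)); last first.
  by apply: le_measure => //; rewrite inE.
rewrite lebesgue_measure_itv/= lte_fin.
have -> : t0 < 1 by rewrite /t0 ltr_pdivrMr; lra.
rewrite -EFinD lee_fin /t0 le_eqVlt; apply/orP; left; apply/eqP; field; lra.
Qed.

(** Forward, two points of [K] on a segment issued from [x], far enough apart, determine [s *: x] as
    a sub-convex combination. Backward, the segment from [x] towards [- (s *: x)] has fraction at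
    least [2 s / (1 + s)], which equals [1 - e] exactly for this [s]. *)
Lemma dilate_setE K (e : R) : Ksn setT K -> 0 < e < 1 ->
  dilate_set K e = [set x | K (((1 - e) / (1 + e)) *: x)].
Proof.
move=> [K_neq0 sK oK cK _] /andP[e0 e1].
have K0 := symmetric_convex0 K_neq0 sK cK.
set s := (1 - e) / (1 + e).
have s0 : 0 < s by rewrite divr_gt0; lra.
have s1 : s < 1 by rewrite ltr_pdivrMr; lra.
apply/seteqP; split => x /=.
  case=> [Kx|[y /gap_of_seg_frac]].
    by apply: convex_set_shrink => //; rewrite !ltW.
  case=> //; first by rewrite e0.
  move=> t1 [t2 [t10 t21 t12 K1 K2]].
  set p := (1 - t1) *: x + _ in K1; set q := (1 - t2) *: x + _ in K2.
  have t12_gt0 : 0 < t2 - t1 by lra.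
  (* The endpoint [y] is eliminated through [t2 p - t1 q = (t2 - t1) x]. *)
  have -> : s *: x = (s * (t2 / (t2 - t1))) *: p + (s * (t1 / (t2 - t1))) *: (- q).
    rewrite /p /q scalerN !scalerDr !scalerA opprD addrACA -!scalerBl.
    rewrite [X in _ + X *: y](_ : _ = 0); last by field; lra.
    rewrite scale0r addr0; congr (_ *: _); field.
    by rewrite gt_eqF.
  apply: convex_set_subcomb => //; first exact: symmetric_setN.
  - by rewrite mulr_ge0 ?divr_ge0//; lra.
  - by rewrite mulr_ge0 ?divr_ge0//; lra.
  (* The total weight is at most 1 as soon as [t1 <= e * t2], which follows from [t2 <= 1] and
     [1 - e < t2 - t1]. *)
  rewrite -mulrDr -mulrDl mulrA ler_pdivrMr// mul1r /s mulrAC ler_pdivrMr; nra.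
move=> Ksx; have [Kx|nKx] := pselect (K x); [by left|right].
(* openness of [K] leaves room for a scale [s' > s], hence a strict inequality *)
have [s' [ss' Ks'x]] : exists s', s < s' /\ K (s' *: x).
  have oS : open [set t : R | K ((1 - t) *: 0 + t *: x)].
    exact: open_segment_preimage.
  have /nbhs_ballP[r /= r0 rS] : nbhs s [set t : R | K ((1 - t) *: 0 + t *: x)].
    by apply: open_nbhs_nbhs; split => //=; rewrite scaler0 add0r.
  exists (s + r / 2); split; first by lra.
  have /= := rS (s + r / 2); rewrite scaler0 add0r; apply.
  rewrite /ball/= opprD addrA subrr sub0r normrN ger0_norm; lra.
have s'1 : s' < 1.
  rewrite ltNge; apply/negP => s'1; apply: nKx.
  have -> : x = s'^-1 *: (s' *: x) by rewrite scalerA mulVf ?scale1r//; lra.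
  apply: convex_set_shrink => //; rewrite invr_ge0 invf_le1; lra.
exists (- (s' *: x)).
apply: (lt_le_trans _ (@seg_frac_opp_ge _ _ s' _ _ _ _ _)) => //; last first.
  by apply/andP; split; lra.
rewrite lte_fin ltr_pdivlMr; last by lra.
have : s * (1 + e) = 1 - e by rewrite /s; field; lra.
nra.
Qed.

End Dilation.

(** * Integration over superlevel sets *)

Section LayerCake.
Set Implicit Arguments. Unset Strict Implicit.
Context d (T : measurableType d) (R : realType).
Implicit Types (A B : T -> R).

(** The integral of a nonnegative function is a supremum over the simple functions below it, hence
    monotone as such. This serves for [Phi f], an upper limit over uncountably many [e]. *)
Lemma ge0_le_integral_nonmeasurable (mu : {measure set T -> \bar R})
    (D : set T) (f g : T -> \bar R) :
  (forall x, D x -> (0 <= f x)%E) -> (forall x, D x -> (f x <= g x)%E) ->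
  (\int[mu]_(x in D) f x <= \int[mu]_(x in D) g x)%E.
Proof.
move=> f0 fg.
have g0 x : D x -> (0 <= g x)%E by move=> Dx; exact: le_trans (f0 x Dx) (fg x Dx).
rewrite !ge0_integralE//; apply: le_ereal_sup => _ [h /= hf <-].
exists h => //= x; apply: (le_trans (hf x)).
by rewrite /patch; case: ifPn => // /set_mem; exact: fg.
Qed.

Lemma measurable_fun_between A B :
  measurable_fun setT A -> measurable_fun setT B ->
  measurable_fun setT (fun z : T * R => A z.1 < z.2 <= B z.1).
Proof.
move=> mA mB; apply: measurable_and.
  by apply: measurable_fun_ltr => //; exact: measurableT_comp.
by apply: measurable_fun_ler => //; exact: measurableT_comp.
Qed.

Lemma measurable_between A B :
  measurable_fun setT A -> measurable_fun setT B ->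
  measurable [set z : T * R | A z.1 < z.2 <= B z.1].
Proof.
move=> mA mB; rewrite -[X in measurable X]setTI.
exact: (measurable_fun_between mA mB measurableT (Y := [set true])).
Qed.

Lemma measurable_fun_between_indic A B :
  measurable_fun setT A -> measurable_fun setT B ->
  measurable_fun setT (fun z : T * R => (A z.1 < z.2 <= B z.1)%R%:R : R).
Proof.
move=> mA mB; rewrite [X in measurable_fun _ X](_ : _ =
    \1_[set z : T * R | A z.1 < z.2 <= B z.1]).
  by apply: measurable_indic; exact: measurable_between.
by apply/funext => z; rewrite indicE mem_setE.
Qed.

Lemma measurable_level A B (l : R) :
  measurable_fun setT A -> measurable_fun setT B ->
  measurable [set x : T | A x < l <= B x].
Proof.
move=> mA mB; have := measurable_ysection l (measurable_between mA mB).
by congr measurable; apply/seteqP; split=> x; rewrite /ysection/= ?inE.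
Qed.

Lemma measurable_fun_measure_level (mu : probability T R) A B :
  measurable_fun setT A -> measurable_fun setT B ->
  measurable_fun setT (fun l => mu [set x | A x < l <= B x]).
Proof.
move=> mA mB; have := measurable_fun_ysection mu (measurable_between mA mB).
congr measurable_fun; apply/funext => l /=; congr (mu _).
by apply/seteqP; split=> x; rewrite /ysection/= ?inE.
Qed.

Lemma integral_indic_itv (a b c : R) : a <= b ->
  (\int[lebesgue_measure]_l (c * (a < l <= b)%R%:R)%:E = (c * (b - a))%:E)%E.
Proof.
move=> ab; under eq_integral do rewrite EFinM.
rewrite integralZl//; last first.
  rewrite [X in integrable _ _ X](_ : _ = EFin \o \1_(`]a, b])); last first.
    by apply/funext => l /=; rewrite indicE mem_setE in_itv.
  exact: integrable_indic_itv.
rewrite [X in (_ * X)%E](_ : _ = (b - a)%:E) ?EFinM//.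
under eq_integral => l _.
  rewrite [X in X%:E](_ : _ = \1_(`]a, b]) l); last by rewrite indicE mem_setE in_itv.
  over.
rewrite integral_indic// setIT [LHS](lebesgue_measure_itv `]a, b])/= lte_fin.
by case: ltgtP ab => //= -> _; rewrite subrr.
Qed.

(** Layer cake: [B x - A x] is the length of the interval of levels [l] with [A x < l <= B x], and
    Tonelli exchanges the two integrals. *)
Lemma integral_measure_level (mu : probability T R) A B :
  measurable_fun setT A -> measurable_fun setT B ->
  (forall x, A x <= B x) ->
  (\int[mu]_x (B x - A x)%:E =
   \int[lebesgue_measure]_l mu [set x | (A x < l <= B x)%R])%E.
Proof.
move=> mA mB AB.
transitivity (\int[mu]_x \int[lebesgue_measure]_l (A x < l <= B x)%R%:R%:E)%E.
  apply: eq_integral => x _; rewrite -[in LHS](mul1r (B x - A x)).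
  by rewrite -integral_indic_itv//; apply: eq_integral => l _; rewrite mul1r.
rewrite (@fubini_tonelli _ _ _ _ R mu lebesgue_measure
  (fun z : T * R => (A z.1 < z.2 <= B z.1)%R%:R%:E)) /=; last 2 first.
- apply/measurable_EFinP.
  exact: measurable_fun_between_indic.
- by move=> z; rewrite lee_fin.
apply: eq_integral => l _.
under eq_integral => x _.
  rewrite [X in X%:E](_ : _ = \1_[set x | A x < l <= B x] x); last first.
    by rewrite indicE mem_setE.
  over.
by rewrite integral_indic ?setIT//; exact: measurable_level.
Qed.

End LayerCake.

(** * Entropy is bounded by the entropies of the superlevel sets *)

Section EntropyLevelSets.
Set Implicit Arguments. Unset Strict Implicit.
Context (R : realType).

Lemma ln_le_subr1 (x : R) : 0 < x -> ln x <= x - 1.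
Proof. by move=> x0; rewrite -[in ln _](subrKC 1 x); apply: le_ln1Dx; lra. Qed.

Lemma oppr_xlnx_ge0 (x : R) : 0 <= x <= 1 -> 0 <= - x * ln x.
Proof. by move=> /andP[x0 x1]; rewrite mulNr oppr_ge0 mulr_ge0_le0// ln_le0. Qed.

Context d (T : measurableType d) (mu : probability T R) (F : T -> R).
Hypotheses (mF : measurable_fun setT F) (F0 : forall x, 0 <= F x).

(** The condition [0 < l] empties the set for [l <= 0], so that integrals over levels can run over
    the whole real line. *)
Let S (l : R) : set T := [set x | 0 < l <= F x].

Definition level_mass (l : R) : R := fine (mu (S l)).
Local Notation m := level_mass.

Lemma measurable_superlevel l : measurable (S l).
Proof. exact: (measurable_level (A := cst 0) l (measurable_cst _) mF). Qed.

Lemma level_massE l : mu (S l) = (m l)%:E.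
Proof. by rewrite fineK// fin_num_measure//; exact: measurable_superlevel. Qed.

Lemma level_mass01 l : 0 <= m l <= 1.
Proof.
rewrite -!lee_fin -level_massE measure_ge0/=.
by apply: probability_le1; exact: measurable_superlevel.
Qed.

Lemma measurable_level_mass : measurable_fun setT m.
Proof.
apply/measurable_EFinP.
rewrite [X in measurable_fun _ X](_ : _ = fun l => mu (S l)); last first.
  by apply/funext => l /=; rewrite level_massE.
exact: (measurable_fun_measure_level mu (measurable_cst (0:R)) mF).
Qed.

Lemma integral_level_mass :
  (\int[lebesgue_measure]_l (m l)%:E = \int[mu]_x (F x)%:E)%E.
Proof.
under eq_integral do rewrite -level_massE.
rewrite -(integral_measure_level mu (measurable_cst (0:R)) mF)//.
by under eq_integral do rewrite subr0.
Qed.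

(** [c] plays the role of the mean of [F]; asking only for an upper bound keeps it positive when [F]
    vanishes almost everywhere. *)
Variable (c : R).
Hypotheses (c0 : 0 < c) (Fc : (\int[mu]_x (F x)%:E <= c%:E)%E).

(* [ln 0 = 0], so replacing the value [0] of [level_mass] by [1] keeps its [ln] *)
Let p (l : R) : R := if m l == 0 then 1 else m l.

Let p_gt0 l : 0 < p l.
Proof.
rewrite /p; case: ifPn => // mN0.
by rewrite lt_def mN0; case/andP: (level_mass01 l).
Qed.

Let p_le1 l : p l <= 1.
Proof. by rewrite /p; case: ifPn => // _; case/andP: (level_mass01 l). Qed.

Let measurable_p : measurable_fun setT p.
Proof.
apply: measurable_fun_if => //.
- by apply: measurable_fun_eqr => //; exact: measurable_level_mass.
- by apply: measurable_funTS; exact: measurable_level_mass.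
Qed.

(** Right-hand side of the tangent-line bound [ln y <= y - 1] at [y = F p / c], cut off to the
    levels below [F]. It is nonnegative because [p <= 1], so Tonelli applies to it directly. *)
Let k (z : T * R) : R :=
  (0 < z.2 <= F z.1)%R%:R * (F z.1 * p z.2 / c - ln (p z.2)).

Let k_ge0 z : 0 <= k z.
Proof.
rewrite mulr_ge0// subr_ge0 (@le_trans _ _ 0)//; first exact: ln_le0.
by rewrite divr_ge0 ?mulr_ge0// ltW.
Qed.

Let measurable_k : measurable_fun setT (EFin \o k).
Proof.
apply/measurable_EFinP; apply: measurable_funM.
  exact: (measurable_fun_between_indic (measurable_cst (0:R)) mF).
have mp : measurable_fun setT (fun z : T * R => p z.2).
  exact: measurableT_comp.
have mF1 : measurable_fun setT (fun z : T * R => F z.1).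
  exact: measurableT_comp.
apply: measurable_funB; last exact: measurableT_comp.
by apply: measurable_funM => //; exact: measurable_funM.
Qed.

Let H (x : T) : R := F x * ln (F x) - F x * ln c + F x.

(* integrate [ln (F / c) + 1 <= F p / c - ln p] over [0 < l <= F x] *)
Let H_le x : ((H x)%:E <= \int[lebesgue_measure]_l (k (x, l))%:E)%E.
Proof.
have [H0|H0] := ltP 0 (H x); last first.
  rewrite (@le_trans _ _ 0%E) ?lee_fin//.
  by apply: integral_ge0 => l _; rewrite lee_fin.
have Fx0 : 0 < F x.
  rewrite lt_def F0 andbT; apply/eqP => Fx0.
  by move: H0; rewrite /H Fx0 !mul0r subrr addr0 ltxx.
have -> : H x = (ln (F x) - ln c + 1) * (F x - 0) by rewrite /H; ring.
have h0 : 0 <= ln (F x) - ln c + 1.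
  by rewrite -(pmulr_rge0 _ Fx0) ltW//; move: H0; rewrite /H; lra.
rewrite -integral_indic_itv//; apply: ge0_le_integral_nonmeasurable => l _.
  by rewrite lee_fin mulr_ge0.
rewrite lee_fin mulrC ler_wpM2l//=.
have /ln_le_subr1 : 0 < F x * p l / c by rewrite divr_gt0// mulr_gt0.
rewrite ln_div ?lnM ?posrE ?mulr_gt0//; lra.
Qed.

(** From [ln (c / F) <= c / F - 1] one gets [F ln (F / c) >= F - c]. The lower bound [- c] on [H]
    allows comparing integrals before [F ln F] is known to be integrable. *)
Let Hc_ge0 x : 0 <= H x + c.
Proof.
have [Fx0|Fx_le0] := ltP 0 (F x); last first.
  have -> : H x = 0.
    by rewrite /H (_ : F x = 0) ?mul0r ?subrr ?addr0//; apply/le_anti/andP.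
  by rewrite add0r ltW.
have : ln c - ln (F x) <= c / F x - 1.
  by rewrite -ln_div ?posrE//; apply: ln_le_subr1; rewrite divr_gt0.
rewrite -(ler_pM2l Fx0) mulrBr [X in _ <= X]mulrBr mulr1 mulrCA divff ?mulr1.
  rewrite /H; have := F0 x; lra.
by rewrite gt_eqF.
Qed.

(** Bounding the integral of [F] over [S l] by [c] turns [F p / c] into [p = m l]; the constant
    [- ln p] contributes [- m ln m]. *)
Let integral_k_le l :
  (\int[mu]_x (k (x, l))%:E <= (m l)%:E + (- m l * ln (m l))%:E)%E.
Proof.
have mS := measurable_superlevel l.
have -> : (\int[mu]_x (k (x, l))%:E =
    \int[mu]_(x in S l) ((p l / c)%:E * (F x)%:E + (- ln (p l))%:E))%E.
  rewrite [RHS]integral_mkcond; apply: eq_integral => x _.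
  rewrite /patch /k /=; case: ifPn => [/set_mem/= ->|/negP nSx]; last first.
    rewrite (_ : (0 < l <= F x) = false) ?mul0r//.
    by apply/negP => Sx; apply: nSx; exact/mem_set.
  by rewrite mul1r -EFinM -EFinD; congr EFin; ring.
have mFS : measurable_fun (S l) (fun x => ((p l / c)%:E * (F x)%:E)%E).
  apply: emeasurable_funM => //; apply/measurable_EFinP.
  exact: measurable_funTS.
have lnp0 : (0 <= (- ln (p l))%:E)%E by rewrite lee_fin oppr_ge0 ln_le0.
(* Here [p l = 1] differs from [m l], but the integral over the null set [S l] vanishes. *)
have [m0|mN0] := eqVneq (m l) 0.
  rewrite null_set_integral//.
  - by rewrite m0 oppr0 mul0r adde0.
  - exact: emeasurable_funD.
  - by rewrite [LHS]level_massE m0.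
have pc0 : 0 <= p l / c by rewrite divr_ge0// ltW.
rewrite ge0_integralD//; last by move=> x _; rewrite -EFinM lee_fin mulr_ge0.
rewrite (integral_cst mu mS) [X in (_ * X)%E]level_massE ge0_integralZl//; last 2 first.
- by apply/measurable_EFinP; exact: measurable_funTS.
- by move=> x _; rewrite lee_fin.
have pm : p l = m l by rewrite /p (negPf mN0).
rewrite pm -EFinM mulNr [ln _ * _]mulrC -mulNr leeD2r//.
have -> : (m l)%:E = ((m l / c)%:E * c%:E)%E by rewrite -EFinM divfK// gt_eqF.
rewrite -pm lee_wpmul2l ?lee_fin// (le_trans _ Fc)//.
apply: ge0_subset_integral => //; first exact/measurable_EFinP.
by move=> x _; rewrite lee_fin.
Qed.

Let integral_k :
  (\int[mu]_x \int[lebesgue_measure]_l (k (x, l))%:E <=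
   \int[mu]_x (F x)%:E + \int[lebesgue_measure]_l (- m l * ln (m l))%:E)%E.
Proof.
rewrite (@fubini_tonelli _ _ _ _ R mu lebesgue_measure (EFin \o k))//=.
have mm := measurable_level_mass.
have mln : measurable_fun setT (fun l => - m l * ln (m l)).
  apply: measurable_funM; first exact: measurableT_comp.
  exact: measurableT_comp.
rewrite -integral_level_mass -ge0_integralD//=.
- apply: ge0_le_integral_nonmeasurable => l _; last exact: integral_k_le.
  by apply: integral_ge0 => x _; rewrite lee_fin.
- by move=> l _; rewrite lee_fin; case/andP: (level_mass01 l).
- exact/measurable_EFinP.
- by move=> l _; rewrite lee_fin oppr_xlnx_ge0// level_mass01.
- exact/measurable_EFinP.
Qed.

(** Integrating [H_le] gives the bound with an extra mean of [F] on each side: on the left from the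
    summand [F] of [H], on the right from the integral of [m]. The two cancel once all terms are
    finite. *)
Lemma entropy_le_level_mass :
  (\int[mu]_x (F x * ln (F x))%:E - \int[mu]_x (F x)%:E * (ln c)%:E <=
   \int[lebesgue_measure]_l (- m l * ln (m l))%:E)%E.
Proof.
set E := (X in (_ <= X)%E).
have E0 : (0 <= E)%E.
  by apply: integral_ge0 => l _; rewrite lee_fin oppr_xlnx_ge0// level_mass01.
have [->|/eqP Eoo] := eqVneq E +oo%E; first by rewrite leey.
have Efin : E \is a fin_num by rewrite ge0_fin_numE// ltey; exact/eqP.
have M0 : (0 <= \int[mu]_x (F x)%:E)%E.
  by apply: integral_ge0 => x _; rewrite lee_fin.
have Mfin : (\int[mu]_x (F x)%:E)%E \is a fin_num.
  by rewrite ge0_fin_numE// (le_lt_trans Fc)// ltry.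
have mH : measurable_fun setT H.
  apply: measurable_funD => //; apply: measurable_funB.
    by apply: measurable_funM => //; exact: measurableT_comp.
  exact: measurable_funM.
have cE : (\int[mu]_x c%:E = c%:E)%E.
  rewrite (integral_cst mu measurableT).
  by rewrite [X in (_ * X)%E](@probability_setT _ _ _ mu) mule1.
have Hc_le : (\int[mu]_x (H x + c)%:E <= \int[mu]_x (F x)%:E + E + c%:E)%E.
  apply: (@le_trans _ _
      (\int[mu]_x (\int[lebesgue_measure]_l (k (x, l))%:E + c%:E))%E).
    apply: ge0_le_integral_nonmeasurable => x _; first by rewrite lee_fin.
    by rewrite EFinD leeD2r.
  rewrite ge0_integralD//=.
  - by rewrite cE leeD2r.
  - by move=> x _; apply: integral_ge0 => l _; rewrite lee_fin.
  - apply: (measurable_fun_fubini_tonelli_F (m2 := lebesgue_measure)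
      (EFin \o k)) => //.
  - by move=> x _; rewrite lee_fin ltW.
have iF : mu.-integrable setT (EFin \o F).
  apply/integrableP; split; first exact/measurable_EFinP.
  under eq_integral => x _ do rewrite /= ger0_norm//.
  by rewrite -ge0_fin_numE.
have iHc : mu.-integrable setT (EFin \o (fun x => H x + c)).
  apply/integrableP; split.
    by apply/measurable_EFinP; exact: measurable_funD.
  under eq_integral => x _ do rewrite /= ger0_norm//.
  by rewrite (le_lt_trans Hc_le)// ltey_eq 2!fin_numD Mfin Efin.
have ic : mu.-integrable setT (EFin \o cst c).
  exact: finite_measure_integrable_cst.
(* [F ln F] is written through [H + c], [F] and [c], all integrable by now, so that the integral
   splits. *)
have -> : (\int[mu]_x (F x * ln (F x))%:E =
   \int[mu]_x ((H x + c)%:E + ((ln c - 1)%:E * (F x)%:E - c%:E)))%E.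
  apply: eq_integral => x _; rewrite -EFinM -EFinB -EFinD; congr EFin.
  by rewrite /H; ring.
have iF' : mu.-integrable setT (fun x => ((ln c - 1)%:E * (F x)%:E)%E).
  exact: integrableZl.
rewrite integralD//; last exact: integrableB.
rewrite integralB// integralZl// cE.
move: Hc_le Mfin Efin {Eoo}.
case: (\int[mu]_x (F x)%:E)%E M0 => // M _; case: E E0 => // e _ + _ _.
have : (0 <= \int[mu]_x (H x + c)%:E)%E.
  by apply: integral_ge0 => x _; rewrite lee_fin.
case: (\int[mu]_x (H x + c)%:E)%E => [h| |]// _.
by rewrite -!EFinM -!EFinD !lee_fin; lra.
Qed.

End EntropyLevelSets.

(** * Reverse Fatou lemma with an integrable majorant *)

Section ReverseFatou.
Set Implicit Arguments. Unset Strict Implicit.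
Context (R : realType).
Local Open Scope ereal_scope.

Lemma le_limn_einf (u v : (\bar R)^nat) :
  (forall k, u k <= v k) -> limn_einf u <= limn_einf v.
Proof.
move=> uv; rewrite !limn_einf_lim; apply: lee_lim; try exact: is_cvg_einfs.
apply: nearW => k; apply: le_ereal_inf_tmp => _ [j /= kj <-].
by apply: (le_trans _ (uv j)); apply: ereal_inf_lbound; exists j.
Qed.

(** The tail suprema [h k] dominate [f k], stay below [g] and converge to the upper limit, so
    dominated convergence applies to them. *)
Lemma limn_einf_integral_le d (T : measurableType d)
    (mu : {measure set T -> \bar R}) (f : (T -> \bar R)^nat) (g : T -> \bar R) :
  (forall k, measurable_fun setT (f k)) -> mu.-integrable setT g ->
  (forall k x, 0 <= f k x) -> (forall k x, f k x <= g x) ->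
  limn_einf (fun k => \int[mu]_x f k x) <= \int[mu]_x limn_esup (f ^~ x).
Proof.
move=> mf ig f0 fg; pose h k x := esups (f ^~ x) k.
have fh k x : f k x <= h k x by apply: ereal_sup_ubound; exists k => /=.
have h0 k x : 0 <= h k x by exact: le_trans (fh k x).
have hg k x : h k x <= g x by apply: ge_ereal_sup => _ [j _ <-].
have h_cvg x : h ^~ x @ \oo --> limn_esup (f ^~ x).
  by rewrite limn_esup_lim; exact: is_cvg_esups.
have [_ _ cvgh] : [/\ mu.-integrable setT (fun x => limn_esup (f ^~ x)),
    [sequence \int[mu]_x `|h k x - limn_esup (f ^~ x)|]_k @ \oo --> 0 &
    [sequence \int[mu]_x h k x]_k @ \oo --> \int[mu]_x limn_esup (f ^~ x)].
  apply: (dominated_convergence _ _ _ _ ig) => //.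
  - exact: measurable_fun_esups.
  - exact: measurable_fun_limn_esup.
  - by apply: aeW => x _; exact: h_cvg.
  - by apply: aeW => x k _; rewrite gee0_abs.
have [<- _] := cvg_limn_einf_sup cvgh.
apply: le_limn_einf => k.
by apply: ge0_le_integral_nonmeasurable.
Qed.

End ReverseFatou.

(** * The functional inequality *)

Section BorelRn.
Set Implicit Arguments. Unset Strict Implicit.
Context (R : realType) (n : nat).
Local Notation V := 'rV[R]_n.
Implicit Types (Om : set V) (f : V -> R).

Lemma open_measurable_Rn (A : set V) : open A -> measurable (A : set (Rn R n)).
Proof. by move=> oA; exact: sub_sigma_algebra. Qed.

Lemma in_continuous_measurable_Rn Om f : open Om ->
  {in Om, continuous f} -> measurable_fun (Om : set (Rn R n)) (f : Rn R n -> R).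
Proof.
move=> oO cf.
apply: (measurability _ (RGenOInfty.measurableE R)) => _ [_ [a ->] <-].
apply: open_measurable_Rn; rewrite openE => x [xO /= fx].
apply: filterI; first exact: open_nbhs_nbhs.
apply: cf; first exact/mem_set.
apply: open_nbhs_nbhs; split=> //; exact: itv_open.
Qed.

Lemma continuous_measurable_patch Om f : open Om ->
  {in Om, continuous f} -> measurable_fun setT (f \_ Om : Rn R n -> R).
Proof.
move=> oO cf; apply/(measurable_restrictT _ (open_measurable_Rn oO)).
exact: in_continuous_measurable_Rn.
Qed.

Lemma continuous_scale Om f (s : R) : symmetric_convex_domain Om ->
  {in Om, continuous f} -> 0 <= s <= 1 ->
  {in Om, continuous (fun x : V => f (s *: x))}.
Proof.
move=> [neO oO cO sO] cf s01 x /set_mem xO.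
have cs : {for x, continuous ( *:%R s : V -> V)} by exact: scaler_continuous.
apply: (continuous_comp cs).
apply: cf; apply/mem_set; apply: convex_set_shrink => //.
exact: symmetric_convex0.
Qed.

End BorelRn.

(** * From the dilation inequality to the entropy bound *)

Section FunctionalInequality.
Set Implicit Arguments. Unset Strict Implicit.
Context (R : realType) (n : nat).
Local Notation V := 'rV[R]_n.
Variables (Om : set V) (mu : probability (Rn R n) R) (kappa : R) (f : V -> R).
Hypotheses (dom : symmetric_convex_domain Om)
  (muOm : mu (Om : set (Rn R n)) = 1%E) (kappa0 : 0 < kappa)
  (dil : dilation_ineq mu Om kappa) (qc : QC1 mu Om f).

Let mOm : measurable (Om : set (Rn R n)).
Proof. by case: dom => _ oO _ _; exact: open_measurable_Rn. Qed.

Let f0 x : Om x -> 0 <= f x.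
Proof. by case: qc => -[+ _ _ _ _] _; exact. Qed.

Let cf : {in Om, continuous f}.
Proof.
by case: qc => -[_ + _ _ _] _; case: dom => _ oO _ _; rewrite continuous_open_subspace.
Qed.

Let Om_scale x (s : R) : 0 <= s <= 1 -> Om x -> Om (s *: x).
Proof.
move=> s01 xO; case: dom => neO _ cO sO; apply: convex_set_shrink => //.
exact: symmetric_convex0.
Qed.

(** If [f x < f (s *: x)], the convex set where [f] is below [f (s *: x)] contains [x] and [- x],
    hence also [s *: x] between them, which is absurd. *)
Lemma quasiconvex_scale_le x (s : R) : Om x -> 0 <= s <= 1 -> f (s *: x) <= f x.
Proof.
move=> xO /andP[s0 s1]; rewrite leNgt; apply/negP => fx.
case: qc => -[_ _ sf qf _] _; case: dom => _ _ _ sO.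
have := @qf (f (s *: x)) x (- x) ((1 - s) / 2) (conj xO fx).
rewrite /= sf//.
have -> : (1 - (1 - s) / 2) *: x + ((1 - s) / 2) *: - x = s *: x.
  by rewrite scalerN -scalerBl; congr (_ *: _); field.
rewrite ltxx => /(_ (conj (symmetric_setN sO xO) fx)) H.
by have /H[] : 0 <= (1 - s) / 2 <= 1 by lra.
Qed.

(** Extension by 0 outside [Om] gives access to the level-set lemmas, which integrate over the whole
    space. *)
Let F (s : R) : Rn R n -> R := (fun x => f (s *: x)) \_ Om.

Let F_in s x : Om x -> F s x = f (s *: x).
Proof. by move=> xO; rewrite /F patchT//; exact/mem_set. Qed.

Let F_out s x : ~ Om x -> F s x = 0.
Proof. by move=> NxO; rewrite /F patchN//; apply/negP => /set_mem. Qed.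

Let F1_in x : Om x -> F 1 x = f x.
Proof. by move=> xO; rewrite F_in// scale1r. Qed.

Let F_ge0 s x : 0 <= s <= 1 -> 0 <= F s x.
Proof.
move=> s01; have [xO|NxO] := pselect (Om x); last by rewrite F_out.
by rewrite F_in//; apply: f0; exact: Om_scale.
Qed.

Let F_le s x : 0 <= s <= 1 -> F s x <= F 1 x.
Proof.
move=> s01; have [xO|NxO] := pselect (Om x); last by rewrite !F_out.
by rewrite F1_in// F_in// quasiconvex_scale_le.
Qed.

Let measurable_F s : 0 <= s <= 1 -> measurable_fun setT (F s).
Proof.
move=> s01; case: (dom) => _ oO _ _.
by apply: continuous_measurable_patch => //; exact: continuous_scale.
Qed.

Let zero_one_one : 0 <= (1 : R) <= 1.
Proof. by rewrite ler01 lexx. Qed.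
Let F1_ge0 x : 0 <= F 1 x.
Proof. exact: F_ge0. Qed.
Let mF1 : measurable_fun setT (F 1).
Proof. exact: measurable_F. Qed.

Local Notation m := (level_mass mu (F 1)).

Let K (l : R) : set V := [set x | Om x /\ f x < l].

Let Ksn_K l : K l !=set0 -> Ksn Om (K l).
Proof.
case: qc => -[_ _ sf qf _] _; case: (dom) => _ oO _ sO Kl0; split => //.
- apply/seteqP; split=> [_ [x [xO fx] <-]|x [xO fx]].
    by split; [exact: symmetric_setN|rewrite sf].
  by exists (- x); rewrite ?opprK//; split; [exact: symmetric_setN|rewrite sf].
- rewrite openE => x [xO fx]; apply: filterI; first exact: open_nbhs_nbhs.
  apply: (cf (mem_set xO) (t := [set y | y < l])); apply: open_nbhs_nbhs; split => //.
- exact: qf.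
- by move=> x [].
Qed.

Let measure_Om (A : set (Rn R n)) : measurable A -> mu A = mu (A `&` Om).
Proof.
move=> mA; have muC0 : mu (~` Om) = 0%E by rewrite probability_setC// muOm subee.
rewrite -{1}(setIT A) -(setUv Om) setIUr measureU; last 3 first.
- exact: measurableI.
- by apply: measurableI => //; exact: measurableC.
- by rewrite setIACA setICr setI0.
rewrite [X in (_ + X)%E](_ : _ = 0%E) ?adde0//.
apply: subset_measure0 muC0 => //; last exact: measurableC.
by apply: measurableI => //; exact: measurableC.
Qed.

Let measure_K l : 0 < l -> measurable (K l : set (Rn R n)) ->
  1 - fine (mu (K l : set (Rn R n))) = m l.
Proof.
move=> l0 mK.
have -> : m l = fine (mu (Om `\` K l)).
  congr (fine (mu _)); apply/seteqP; split=> x /=.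
    have [xO|NxO] := pselect (Om x); last by rewrite F_out// => /andP[/lt_geF ->].
    by rewrite F1_in// => /andP[_ lf]; split=> // -[_]; rewrite ltNge lf.
  by move=> [xO nK]; rewrite F1_in// l0/= leNgt; apply/negP => fl; apply: nK.
have muOm_fin : (mu (Om : set (Rn R n)) < +oo)%E by rewrite muOm ltry.
have -> : mu (Om `\` K l) = (1 - mu (K l : set (Rn R n)))%E.
  have KE : Om `&` K l = K l by apply/setIidPr => x [].
  by rewrite -muOm -[in RHS]KE; exact: measureD.
by rewrite fineB ?fin_num_measure.
Qed.

Let scale (e : R) : R := (1 - e) / (1 + e).

Let scale01 e : 0 < e < 1 -> 0 <= scale e <= 1.
Proof.
by move=> /andP[e0 e1]; rewrite /scale divr_ge0 ?ler_pdivrMr ?mul1r; lra.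
Qed.

(** By [dilate_setE] the dilated set consists of the [x] with [s *: x] in [K l]. It may leave [Om],
    where [mu] has no mass; inside [Om] it is given by [f (s *: x) < l] and contains [K l] by
    monotonicity along rays. *)
Let measure_dilate_diff l e : K l !=set0 -> 0 < e < 1 ->
  (mu (dilate_set (K l) e : set (Rn R n)) - mu (K l : set (Rn R n)) =
   mu [set x | (F (scale e) x < l <= F 1 x)%R])%E.
Proof.
move=> Kl0 e01; have [K_neq0 sK oK cK KO] := Ksn_K Kl0.
have l0 : 0 < l by case: Kl0 => x [/f0 fx]; exact: le_lt_trans.
have mK : measurable (K l : set (Rn R n)) by exact: open_measurable_Rn.
rewrite dilate_setE//.
set D := [set x | _].
have mD : measurable (D : set (Rn R n)).
  by apply: open_measurable_Rn; exact: open_scale_preimage.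
rewrite (measure_Om mD).
have KD : (D `&` Om) `&` K l = K l.
  apply/setIidPr => x [xO fx]; split => //; split; first exact/Om_scale/xO/scale01.
  by apply: le_lt_trans fx; apply: quasiconvex_scale_le => //; exact: scale01.
rewrite -[X in (_ - mu X)%E]KD -measureD//; last 2 first.
- exact: measurableI.
- by rewrite -ge0_fin_numE// fin_num_measure//; exact: measurableI.
congr (mu _); apply/seteqP; split=> x /=.
  move=> [[[sxO fsx] xO] nK]; rewrite F1_in// F_in// fsx/= leNgt.
  by apply/negP => fx; apply: nK.
have [xO|NxO] := pselect (Om x); last first.
  by rewrite !F_out// => /andP[/lt_geF ->].
rewrite F1_in// F_in// => /andP[fsx fx]; split; last by move=> [_]; rewrite ltNge fx.
by split=> //; split=> //; exact/Om_scale/xO/scale01.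
Qed.

(** A sequence is needed for the Fatou lemmas. Dividing by [k + 2] keeps even the first term
    strictly below [e0], where the majorant [g] is valid. *)
Let eps (e0 : R) (k : nat) : R := e0 / k.+2%:R.

Let eps_bound e0 k : 0 < e0 <= 1 -> 0 < eps e0 k < 1 /\ eps e0 k < e0.
Proof.
move=> /andP[e00 e01].
have : eps e0 k < e0 by rewrite /eps ltr_pdivrMr// ltr_pMr// ltr1n.
have : 0 < eps e0 k by rewrite divr_gt0.
by move=> -> h; split=> //=; exact: lt_le_trans h _.
Qed.

Let eps_near0 e0 (r : R) : 0 < e0 <= 1 -> 0 < r -> \forall k \near \oo, eps e0 k < r.
Proof.
move=> /andP[e00 e01] r0; near=> k.
rewrite /eps ltr_pdivrMr// (le_lt_trans e01)// mulrC -ltr_pdivrMr//.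
have : (1 / r) < k%:R by near: k; exact: nbhs_infty_gtr.
by move=> /lt_trans; apply; rewrite ltr_nat.
Unshelve. all: by end_near. Qed.

(** This is the dilation inequality for [K l] read along the sequence [eps]. Where it does not
    apply, [m l] is 0 (for [l <= 0]) or 1 (for [K l] empty), and [m ln m] vanishes. *)
Let mass_le_liminf e0 l : 0 < e0 <= 1 ->
  ((kappa * (- m l * ln (m l)))%:E <=
   limn_einf (fun k => mu [set x | (F (scale (eps e0 k)) x < l <= F 1 x)%R] *
                       ((eps e0 k)^-1)%:E))%E.
Proof.
move=> e001.
have rhs_ge0 : (0 <= limn_einf (fun k =>
    mu [set x | (F (scale (eps e0 k)) x < l <= F 1 x)%R] * ((eps e0 k)^-1)%:E))%E.
  rewrite limn_einf_lim; apply: lime_ge; first exact: is_cvg_einfs.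
  apply: nearW => k; apply: le_ereal_inf_tmp => _ [j _ <-].
  rewrite mule_ge0// lee_fin invr_ge0.
  by have [/andP[/ltW]] := eps_bound j e001.
have [l0|l0] := ltP 0 l; last first.
  have -> : m l = 0.
    rewrite /level_mass (_ : [set x | _] = set0) ?measure0//.
    by apply/seteqP; split=> // x /=; rewrite ltNge l0.
  by rewrite oppr0 mul0r mulr0.
have [K0|/set0P Kl0] := eqVneq (K l) set0.
  have -> : m l = 1.
    by rewrite -measure_K// K0 ?measure0 ?subr0//; exact: measurable0.
  by rewrite ln1 !mulr0.
have [_ _ oK _ _] := Ksn_K Kl0.
have := dil (Ksn_K Kl0); rewrite measure_K//; last exact: open_measurable_Rn.
rewrite -[X in X%:E](_ : kappa * (- m l * ln (m l)) = _); last by ring.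
move=> /le_trans; apply; rewrite /mu_star; apply: ge_ereal_sup => _ [d /= + <-].
rewrite in_itv/= => /andP[d0 d1].
rewrite limn_einf_lim; apply: lime_ge; first exact: is_cvg_einfs.
(* Once [eps e0 k < d], the tail from [k] on only uses values in []0, d[], so its infimum is at
   least the one over that interval. *)
near=> k; have ekd : eps e0 k < d by near: k; exact: eps_near0.
apply: le_ereal_inf_tmp => _ [j /= kj <-].
have [e_01 _] := eps_bound j e001.
rewrite -measure_dilate_diff//; apply: ereal_inf_lbound; exists (eps e0 j) => //=.
rewrite in_itv/=; case/andP: e_01 => -> _ /=.
apply: le_lt_trans ekd.
by rewrite /eps ler_pM2l ?lef_pV2 ?posrE// ?ler_nat//; have /andP[] := e001.
Unshelve. all: by end_near. Qed.

Let quotient_integral e0 k : 0 < e0 <= 1 ->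
  (\int[lebesgue_measure]_l
     (mu [set x | (F (scale (eps e0 k)) x < l <= F 1 x)%R] * ((eps e0 k)^-1)%:E) =
   \int[mu]_x ((F 1 x - F (scale (eps e0 k)) x) / eps e0 k)%:E)%E.
Proof.
move=> e001; have [e_01 _] := eps_bound k e001.
have s01 := scale01 e_01; have e_ge0 : 0 <= (eps e0 k)^-1.
  by rewrite invr_ge0; case/andP: e_01 => /ltW.
rewrite ge0_integralZr//; last exact: measurable_fun_measure_level (measurable_F s01) mF1.
rewrite -(integral_measure_level mu (measurable_F s01) mF1); last first.
  by move=> x; exact: F_le.
rewrite -ge0_integralZr//.
- apply/measurable_EFinP; apply: measurable_funB => //; exact: measurable_F.
- by move=> x _; rewrite lee_fin subr_ge0 F_le.
Qed.

(** Difference quotients are nonnegative by monotonicity along rays. In the differentiable case this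
    sign lets the factor 2 leave the integral. *)
Lemma Phi_ge0 x : Om x -> (0 <= Phi f x)%E.
Proof.
move=> xO; apply: le_ereal_inf_tmp => _ [d /= + <-].
rewrite in_itv/= => /andP[d0 d1].
apply: (@le_trans _ _ (dq f x (d / 2))%:E).
  rewrite lee_fin /dq divr_ge0//; last by lra.
  by rewrite subr_ge0 quasiconvex_scale_le// scale01//; lra.
by apply: ereal_sup_ubound; exists (d / 2) => //=; rewrite in_itv/=; lra.
Qed.

Lemma entropy_le_integral_Phi :
  (Ent mu Om f <= kappa^-1%:E * \int[mu]_(x in (Om : set (Rn R n))) Phi f x)%E.
Proof.
case: (qc) => -[_ _ _ _ [g [e0 [g0 mg ig e001 gf]]]] iF.
pose psi k (x : Rn R n) : \bar R := ((F 1 x - F (scale (eps e0 k)) x) / eps e0 k)%:E.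
have intF : (\int[mu]_(x in (Om : set (Rn R n))) (f x)%:E = \int[mu]_x (F 1 x)%:E)%E.
  rewrite integral_mkcond; apply: eq_integral => x _; rewrite /patch.
  by case: ifPn => [/set_mem /F1_in ->//|/negP nO]; rewrite F_out// => /mem_set.
have intFln : (\int[mu]_(x in (Om : set (Rn R n))) (f x * ln (f x))%:E =
    \int[mu]_x (F 1 x * ln (F 1 x))%:E)%E.
  rewrite integral_mkcond; apply: eq_integral => x _; rewrite /patch.
  case: ifPn => [/set_mem /F1_in ->//|/negP nO].
  by rewrite F_out ?mul0r// => /mem_set.
have M0 : (0 <= \int[mu]_x (F 1 x)%:E)%E.
  by apply: integral_ge0 => x _; rewrite lee_fin.
have Mfin : (\int[mu]_x (F 1 x)%:E)%E \is a fin_num.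
  by rewrite -intF; exact: integrable_fin_num.
set M := fine (\int[mu]_x (F 1 x)%:E)%E.
(* Since [ln 0 = 0 = ln 1], replacing a zero mean by 1 gives a positive [c] with the same
   logarithm. *)
pose c := if M == 0 then 1 else M.
have M_ge0 : 0 <= M by exact: fine_ge0.
have c0 : 0 < c by rewrite /c; case: ifPn => // MN0; rewrite lt_def MN0.
have Fc : (\int[mu]_x (F 1 x)%:E <= c%:E)%E.
  by rewrite -(fineK Mfin) lee_fin -/M /c; case: ifPn => // /eqP ->.
have lnc : ln M = ln c by rewrite /c; case: ifPn => // /eqP ->; rewrite ln1 ln0.
have kE : (kappa%:E * \int[lebesgue_measure]_l (- m l * ln (m l))%:E <=
           \int[mu]_(x in (Om : set (Rn R n))) Phi f x)%E.
  have mm := measurable_level_mass mu mF1.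
  rewrite -ge0_integralZl//=; last 3 first.
  - apply/measurable_EFinP; apply: measurable_funM; exact: measurableT_comp.
  - by move=> l _; rewrite lee_fin oppr_xlnx_ge0// level_mass01.
  - by rewrite lee_fin ltW.
  apply: (@le_trans _ _ (\int[lebesgue_measure]_l limn_einf (fun k =>
      mu [set x | (F (scale (eps e0 k)) x < l <= F 1 x)%R] * ((eps e0 k)^-1)%:E))%E).
    apply: ge0_le_integral_nonmeasurable => l _.
      by rewrite mule_ge0 ?lee_fin ?(ltW kappa0)// oppr_xlnx_ge0// level_mass01.
    by rewrite -EFinM; exact: mass_le_liminf.
  (* Fatou in the level [l]; the layer cake then turns each integral over levels into one over
     [x]. *)
  apply: le_trans (fatou _ _ _ _) _ => //.
  - move=> k; have [e_01 _] := eps_bound k e001.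
    apply: emeasurable_funM => //.
    exact: measurable_fun_measure_level (measurable_F (scale01 e_01)) mF1.
  - move=> k l _; rewrite mule_ge0// lee_fin invr_ge0.
    by have [/andP[/ltW]] := eps_bound k e001.
  under eq_fun do rewrite quotient_integral//.
  apply: (@le_trans _ _ (\int[mu]_x limn_esup (psi ^~ x))%E).
    apply: (limn_einf_integral_le (f := psi) _ ig).
    - move=> k; have [e_01 _] := eps_bound k e001.
      apply/measurable_EFinP; apply: measurable_funM => //.
      by apply: measurable_funB => //; apply: measurable_F; exact: scale01.
    - move=> k x; have [e_01 _] := eps_bound k e001.
      rewrite lee_fin divr_ge0 ?subr_ge0 ?F_le ?scale01//.
      by case/andP: e_01 => /ltW.
    - move=> k x; have [e_01 e_e0] := eps_bound k e001; rewrite /psi lee_fin.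
      have [xO|NxO] := pselect (Om x); last by rewrite !F_out// subrr mul0r.
      rewrite F1_in// F_in//; apply: gf => //.
      by case/andP: e_01 => ->.
  (* Pointwise, the upper limit along [eps] is at most [Phi f] on [Om], and is 0 outside. *)
  rewrite [leRHS]integral_mkcond; apply: ge0_le_integral_nonmeasurable => x _.
    rewrite limn_esup_lim; apply: lime_ge; first exact: is_cvg_esups.
    apply: nearW => k; apply: (@le_trans _ _ (psi k x)); last first.
      by apply: ereal_sup_ubound; exists k => /=.
    have [e_01 _] := eps_bound k e001.
    rewrite lee_fin divr_ge0 ?subr_ge0 ?F_le ?scale01//.
    by case/andP: e_01 => /ltW.
  rewrite /patch; case: ifPn => [/set_mem xO|/negP NxO]; last first.
    have psi0 k : psi k x = 0%E.
      by rewrite /psi !F_out ?subrr ?mul0r// => /mem_set.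
    rewrite limn_esup_lim; apply: lime_le; first exact: is_cvg_esups.
    by apply: nearW => k; apply: ge_ereal_sup => _ [j _ <-]; rewrite psi0.
  apply: le_ereal_inf_tmp => _ [d /= + <-]; rewrite in_itv/= => /andP[d0 d1].
  rewrite limn_esup_lim; apply: lime_le; first exact: is_cvg_esups.
  near=> k; have ekd : eps e0 k < d by near: k; exact: eps_near0.
  apply: ge_ereal_sup => _ [j /= kj <-].
  rewrite /psi F1_in// F_in//; apply: ereal_sup_ubound; exists (eps e0 j) => //=.
  rewrite in_itv/=; have [/andP[-> _] _] := eps_bound j e001.
  apply: le_lt_trans ekd.
  by rewrite /eps ler_pM2l ?lef_pV2 ?posrE// ?ler_nat//; have /andP[] := e001.
rewrite /Ent intF intFln -/M lnc.
apply: (le_trans (entropy_le_level_mass mF1 F1_ge0 c0 Fc)).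
have kVk : (kappa^-1%:E * kappa%:E = 1)%E by rewrite -EFinM mulVf ?gt_eqF.
rewrite -[leLHS]mul1e -[X in (X * _ <= _)%E]kVk -muleA.
by apply: lee_wpmul2l => //; rewrite lee_fin invr_ge0 ltW.
Unshelve. all: by end_near. Qed.

End FunctionalInequality.

(** * The differentiable case: [Phi] as a radial derivative *)

Section DifferentiableCase.
Set Implicit Arguments. Unset Strict Implicit.
Context (R : realType) (n : nat).
Local Notation V := 'rV[R]_n.
Implicit Types (Om : set V) (f : V -> R) (x : V).

Lemma Phi_cvg f x (l : R) : dq f x e @[e --> 0^'+] --> l -> Phi f x = l%:E.
Proof.
move=> fl; have near_dq (eta : R) : 0 < eta ->
    exists d, 0 < d <= 1 /\ forall e, 0 < e < d -> `|l - dq f x e| < eta.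
  move=> eta0; have /cvgrPdist_lt/(_ _ eta0)[/= r r0 rP] := fl.
  (* The minimum with 1 matches the range []0, 1]] of [d] in [Phi]. *)
  exists (Num.min r 1); split.
    by rewrite lt_min r0 ltr01/= ge_min lexx orbT.
  move=> e /andP[e0]; rewrite lt_min => /andP[er e1]; apply: rP => //=.
  by rewrite sub0r normrN gtr0_norm.
apply/eqP; rewrite eq_le; apply/andP; split.
  apply/lee_addgt0Pr => eta eta0; have [d [d01 dP]] := near_dq _ eta0.
  apply: (@le_trans _ _ (ereal_sup [set (dq f x e)%:E | e in `]0, d[])).
    by apply: ereal_inf_lbound; exists d => //=; rewrite in_itv/=.
  apply: ge_ereal_sup => _ [e /= + <-]; rewrite in_itv/= => /dP.
  by rewrite -EFinD lee_fin ltr_norml; lra.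
apply: le_ereal_inf_tmp => _ [d /= + <-]; rewrite in_itv/= => /andP[d0 d1].
apply/lee_subgt0Pr => eta eta0; have [d' [/andP[d'0 d'1] dP]] := near_dq _ eta0.
pose e := Num.min d d' / 2.
have [e0 ed ed'] : [/\ 0 < e, e < d & e < d'].
  rewrite /e; have : 0 < Num.min d d' by rewrite lt_min d0.
  have : Num.min d d' <= d by rewrite ge_min lexx.
  have : Num.min d d' <= d' by rewrite ge_min lexx orbT.
  by split; lra.
apply: (@le_trans _ _ (dq f x e)%:E).
  have := dP e; rewrite e0 ed' => /(_ isT).
  by rewrite -EFinB lee_fin ltr_norml; lra.
by apply: ereal_sup_ubound; exists e => //=; rewrite in_itv/= e0.
Qed.

Lemma x_dot_gradE f x : differentiable f x -> x_dot_grad f x = 'D_x f x.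
Proof.
move=> df; rewrite /x_dot_grad; under eq_bigr do rewrite (deriveE _ df).
rewrite (deriveE _ df); move: ('d f x) => L.
by rewrite [in RHS](row_sum_delta x) linear_sum; apply: eq_bigr => i _; rewrite linearZ.
Qed.

(** With [h e = - 2 e / (1 + e)] the scaled point is [x + h e *: x], so [dq f x e] is the difference
    quotient [q (h e)] in direction [x] times [2 / (1 + e)], a factor tending to 2. *)
Lemma Phi_differentiable f x : differentiable f x ->
  Phi f x = (2 * x_dot_grad f x)%:E.
Proof.
move=> df; rewrite x_dot_gradE//; apply: Phi_cvg.
pose h (e : R) := - (2 * e / (1 + e)).
pose q (t : R) := t^-1 *: ((f \o shift x) (t *: x) - f x).
have e_cvg : e @[e --> (0 : R)^'+] --> (0 : R) by exact: cvg_within.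
have e1_cvg : (1 + e)^-1 @[e --> (0 : R)^'+] --> (1 : R).
  rewrite -[X in _ --> X]invr1; apply: cvgV; first exact: oner_neq0.
  by rewrite -[X in _ --> X]addr0; apply: cvgD => //; exact: cvg_cst.
have two_cvg : cst (2 : R) e @[e --> (0 : R)^'+] --> (2 : R) by exact: cvg_cst.
have h_cvg0 : h e @[e --> (0 : R)^'+] --> (0 : R).
  rewrite -[X in _ --> X]oppr0; apply: cvgN.
  by have := cvgM (cvgM two_cvg e_cvg) e1_cvg; rewrite mulr0 mul0r; apply.
(* The limit of [q] is taken on punctured neighbourhoods, so [h e] must also avoid 0. *)
have h_cvg : h e @[e --> (0 : R)^'+] --> (0 : R)^'.
  move=> A A0; have := h_cvg0 _ A0; apply: filterS2 (nbhs_right_gt 0) => e e0 /=.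
  by apply; rewrite /h oppr_eq0 gt_eqF// divr_gt0 ?mulr_gt0//; lra.
have q_cvg : q t @[t --> (0 : R)^'] --> 'D_x f x.
  exact: diff_derivable.
have qh_cvg := cvg_comp _ _ h_cvg q_cvg.
have : q (h e) * (2 * (1 + e)^-1) @[e --> (0 : R)^'+] --> 'D_x f x * (2 * 1).
  by apply: cvgM => //; exact: cvgM two_cvg e1_cvg.
rewrite mulr1 mulrC; apply: cvg_trans; apply: near_eq_cvg.
near=> e.
have e0 : 0 < e by near: e; exact: nbhs_right_gt.
rewrite /q /h /dq /=.
have -> : (- (2 * e / (1 + e))) *: x + x = ((1 - e) / (1 + e)) *: x.
  rewrite -{2}(scale1r x) -scalerDl; congr (_ *: _); field; lra.
rewrite /GRing.scale/=; field; lra.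
Unshelve. all: by end_near. Qed.

Lemma measurable_x_dot_grad Om f : open Om -> C1_on Om f ->
  measurable_fun (Om : set (Rn R n)) (x_dot_grad f : Rn R n -> R).
Proof.
move=> oO [_ cD]; apply: measurable_sum => i; apply: measurable_funM.
  apply: (in_continuous_measurable_Rn (f := fun x : V => x 0 i)) => // x _.
  exact: coord_continuous.
apply: (in_continuous_measurable_Rn (f := 'D_(delta_mx 0 i) f)) => //.
by rewrite -continuous_open_subspace.
Qed.

End DifferentiableCase.

Theorem theoremt (R : realType) (n : nat) (Omega : set 'rV[R]_n)
    (mu : probability (Rn R n) R) (kappa : R) :
  symmetric_convex_domain Omega ->
  mu (Omega : set (Rn R n)) = 1%E ->
  0 < kappa ->
  dilation_ineq mu Omega kappa ->
  (forall f : 'rV[R]_n -> R, QC1 mu Omega f ->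
     (Ent mu Omega f <= kappa^-1%:E * \int[mu]_(x in (Omega : set (Rn R n))) Phi f x)%E) /\
  (forall f : 'rV[R]_n -> R, QC1 mu Omega f -> C1_on Omega f ->
     (Ent mu Omega f <= (2 / kappa)%:E *
        \int[mu]_(x in (Omega : set (Rn R n))) (x_dot_grad f x)%:E)%E).
Proof.
move=> dom muO kappa0 dil; split=> [f qc|f qc c1].
  exact: entropy_le_integral_Phi.
apply: (le_trans (entropy_le_integral_Phi dom muO kappa0 dil qc)).
have oO : open Omega by case: dom.
have PhiE x : Omega x -> Phi f x = (2%:E * (x_dot_grad f x)%:E)%E.
  by move=> xO; case: c1 => df _; rewrite Phi_differentiable// ?EFinM//; exact: df.
have -> : (\int[mu]_(x in (Omega : set (Rn R n))) Phi f x =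
    \int[mu]_(x in (Omega : set (Rn R n))) (2%:E * (x_dot_grad f x)%:E))%E.
  by apply: eq_integral => x /set_mem /PhiE.
rewrite ge0_integralZl//.
- by rewrite muleA -EFinM mulrC.
- exact: open_measurable_Rn.
- by apply/measurable_EFinP; exact: measurable_x_dot_grad.
- move=> x xO; have := Phi_ge0 dom qc xO; rewrite PhiE//.
  by rewrite -EFinM !lee_fin; lra.
Qed.
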